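(* Let $\Gamma$ be a compact metric graph with $g(\Gamma)\geq 2$, let $G$ be a (finite) model for $\Gamma$, and let $\phi:\Gamma'\to\Gamma$ be the universal cover. Then the function $R:\mathbb{E}(G)\to\mathbb{R}^{>0}\cup\{+\infty\}$ defined in the context satisfies $$\frac{1}{R(e)}=\sum_{e_i \in S_e}\frac{1}{\ell(e_i)+R(e_i)}$$ for all $e \in \mathbb{E}(G)$, where $S_e = \{e_i \in \mathbb{E}(G) : e_i \ne \bar{e},\ e_i^-=e^+\}$.
   Context: Metric graphs. A metric graph is a connected metric space $\Gamma$ such that, for some fixed $\epsilon>0$, every point has a neighborhood isometric to a star-shaped set $S(n,r)=\{te^{2\pi i k/n} : 0\le t<r,\ k\in\mathbb{Z}\}\subset\mathbb{C}$ of finite valence $n$ and radius $r\geq\epsilon$, endowed with the path metric. $\Gamma$ need not be compact. A vertex set is a discrete subset $V\subset\Gamma$ containing all points of valence $\neq 2$ such that every connected component of $\Gamma\setminus V$ is isometric (in its path metric) to a bounded open interval. It determines a model $G$: the weighted graph with vertex set $V(G)=V$, edge set $E(G)$ the set of components of $\Gamma\setminus V$, and $\ell(e)>0$ the length of the edge $e$ (loops and multiple edges are allowed). $\mathbb{E}(G)$ is the set of oriented edges; each edge has two orientations $e,\bar e\in\mathbb{E}(G)$, with $\ell(\bar e)=\ell(e)$; $e^-$ and $e^+$ are the initial and terminal vertices of $e$. An orientation $\mathcal{O}\subset\mathbb{E}(G)$ selects one orientation of each edge. The genus $g(\Gamma)$ is the dimension of the first homology of $\Gamma$. Forms. $C^1(G,\mathbb{R})$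 is the space of functions $\omega:\mathbb{E}(G)\to\mathbb{R}$ with $\omega(\bar e)=-\omega(e)$; put $\omega_e=\omega(e)/\ell(e)$ and $\|\omega\|^2=\sum_{e\in\mathcal{O}}\omega_e^2\ell(e)$; $\omega$ is $L^2$ if $\|\omega\|<\infty$. Put $d^*\omega=\sum_{v\in V(G)}\big(\sum_{e\in\mathcal{O},\,e^+=v}\omega_e-\sum_{e\in\mathcal{O},\,e^-=v}\omega_e\big)\delta_v$, a signed measure ($\delta_v$ the Dirac measure). Transience. A metric graph $T$ is transient if for some (equivalently, every) $x\in T$ there is an $L^2$ form $\omega$ on $T$ (on some model having $x$ as a vertex) with $d^*\omega=\delta_x$. The function $R$. The universal cover $\Gamma'$ carries the metric for which $\phi$ is isometric on sheets. Let $G'$ be the model of $\Gamma'$ with vertex set $\phi^{-1}(V(G))$; it is a tree. For $e\in\mathbb{E}(G)$ and a lift $e'\in\mathbb{E}(G')$ of $e$, let $T(e')$ be the connected component of $\Gamma'$ minus the interior of $e'$ that contains $e'^+$; its isometry type depends only on $e$. Define $R(e)=+\infty$ if $T(e')$ is not transient, and $R(e)=\inf\|\omega\|^2$ if $T(e')$ is transient, the infimum being over all $L^2$ cochains $\omega$ on $T(e')$ (with the model induced by $G'$) with $d^*\omega=\delta_{e'^+}$. Conventions: $1/(+\infty)=0$, and an empty sum is $0$. *)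

(* Defs.v *)
From HB Require Import structures.
From mathcomp Require Import all_boot all_order all_algebra.
From mathcomp Require Import all_classical all_reals all_analysis.

Set Implicit Arguments.
Unset Strict Implicit.
Unset Printing Implicit Defensive.

Import Order.TTheory GRing.Theory Num.Theory.

Local Open Scope classical_set_scope.
Local Open Scope ring_scope.

(* A metric graph is handled through a model, that is a weighted graph with
   loops and multiple edges allowed.  [V] is the vertex set, [E] the set of
   ORIENTED edges: an edge is a pair {e, erev e} of distinct oriented edges,
   [src e] is e^- and [tgt e] (below) is e^+.  Compact metric graphs
   correspond to the case where [V] and [E] are finite types. *)
Record wgraph (R : realType) (V E : choiceType) := WGraph {
  src : E -> V;
  erev : E -> E;
  len : E -> R;
  erevK : involutive erev;
  erev_neq : forall e, erev e <> e;
  len_gt0 : forall e, 0 < len e;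
  len_erev : forall e, len (erev e) = len e;
  finite_valence : forall v, finite_set [set e | src e = v]
}.

Section Graph.
Variables (R : realType) (V E : choiceType) (G : wgraph R V E).

Definition tgt (e : E) : V := src G (erev G e).

Fixpoint walk (u : V) (p : seq E) (v : V) : Prop :=
  match p with
  | [::] => u = v
  | e :: q => src G e = u /\ walk (tgt e) q v
  end.

Definition wconnected : Prop := forall u v : V, exists p, walk u p v.

(* Homotopy of edge paths with fixed end points: the equivalence relation
   generated by inserting or deleting a backtracking. *)
Inductive homotopic : seq E -> seq E -> Prop :=
| homotopic_backtrack p q e : homotopic (p ++ e :: erev G e :: q) (p ++ q)
| homotopic_refl p : homotopic p p
| homotopic_sym p q : homotopic p q -> homotopic q p
| homotopic_trans p q r : homotopic p q -> homotopic q r -> homotopic p r.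

Definition simply_connected : Prop :=
  wconnected /\ forall v p, walk v p v -> homotopic p [::].

Definition is_orientation (O : set E) : Prop :=
  forall e, O e <-> ~ O (erev G e).

(* [choose] returns the same element for the two orientations of an edge. *)
Definition orientation : set E :=
  [set e | choose (pred2 e (erev G e)) e = e].

Lemma orientationP : is_orientation orientation.
Proof.
move=> e; rewrite /orientation /=.
have -> : choose (pred2 (erev G e) (erev G (erev G e))) (erev G e)
          = choose (pred2 e (erev G e)) e.
  rewrite erevK (@eq_choose _ _ (pred2 e (erev G e))); last first.
    by move=> x /=; rewrite orbC.
  by apply: choose_id; rewrite /= eqxx ?orbT.
have : pred2 e (erev G e) (choose (pred2 e (erev G e)) e).
  by apply: chooseP; rewrite /= eqxx.
move=> /= /orP[] /eqP ->; split=> //.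
- by move=> _ /esym; exact: erev_neq.
- by move=> /erev_neq.
Qed.

(* C^1(G, R) *)
Definition cochain (w : E -> R) : Prop := forall e, w (erev G e) = - w e.

Definition slope (w : E -> R) (e : E) : R := w e / len G e.

Definition sqnorm (w : E -> R) : \bar R :=
  (\esum_(e in orientation) (slope w e ^+ 2 * len G e)%:E)%E.

Definition L2 (w : E -> R) : Prop := (sqnorm w < +oo)%E.

(* The signed measure d^* w is carried by the vertices; it is represented by
   the function sending a vertex to its mass. *)
Definition dstar (w : E -> R) (v : V) : R :=
  \sum_(e \in orientation `&` [set e | tgt e = v]) slope w e
  - \sum_(e \in orientation `&` [set e | src G e = v]) slope w e.

Definition dirac_mass (x v : V) : R := (v == x)%:R.

Definition unit_flows (x : V) : set (E -> R) :=
  [set w | [/\ cochain w, L2 w & dstar w = dirac_mass x]].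

End Graph.

(* [H] is obtained from [T] by subdividing edges: the edge e of T becomes the
   edge path [sub_edge e], whose interior vertices are new and of valence 2.
   [H] and [T] are then models of the same metric graph. *)
Record subdivision (R : realType) (W F V E : choiceType)
    (H : wgraph R W F) (T : wgraph R V E) := Subdivision {
  sub_vert : V -> W;
  sub_edge : E -> seq F;
  sub_vert_inj : injective sub_vert;
  sub_walk : forall e,
    walk H (sub_vert (src T e)) (sub_edge e) (sub_vert (tgt T e));
  sub_erev : forall e, sub_edge (erev T e) = rev (map (erev H) (sub_edge e));
  sub_len : forall e, \sum_(f <- sub_edge e) len H f = len T e;
  sub_uniq : forall e, uniq (sub_edge e);
  sub_cover : forall f, exists! e, f \in sub_edge e;
  sub_interior : forall e p f g q v,
    sub_edge e = p ++ f :: g :: q -> tgt H f <> sub_vert v;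
  sub_valence2 : forall w, (forall v, w <> sub_vert v) ->
    exists f g, f <> g /\ [set h | src H h = w] = [set f; g]
}.

(* Here x is an arbitrary point of the metric graph modelled by T, and H a
   model having x as a vertex. Any two models have a common subdivision, to
   which forms pull back without changing their norm or their image under
   d^*, so subdivisions of T account for all models. *)
Definition transient (R : realType) (V E : choiceType) (T : wgraph R V E)
    : Prop :=
  exists (W F : choiceType) (H : wgraph R W F) (_ : subdivision H T) (x : W),
    unit_flows H x !=set0.

Section Genus.
Variables (R : realType) (V E : finType) (G : wgraph R V E).

(* Cellular 1-chains are the antisymmetric functions on oriented edges, c e
   being the coefficient of e. For these the sum below, over ALL oriented
   edges ending at v, is the coefficient of v in the boundary of c. *)
Definition symmetrization (c : {ffun E -> R^o}) : {ffun E -> R^o} :=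
  [ffun e => c e + c (erev G e)].

Definition boundary (c : {ffun E -> R^o}) : {ffun V -> R^o} :=
  [ffun v => \sum_(e | tgt G e == v) c e].

Fact symmetrization_is_linear : linear symmetrization.
Proof.
by move=> a c d; apply/ffunP => e; rewrite !ffunE scalerDr addrACA.
Qed.

Fact boundary_is_linear : linear boundary.
Proof.
move=> a c d; apply/ffunP => v; rewrite !ffunE scaler_sumr -big_split /=.
by apply: eq_bigr => e _; rewrite !ffunE.
Qed.

HB.instance Definition _ :=
  GRing.isLinear.Build R _ _ _ symmetrization symmetrization_is_linear.
HB.instance Definition _ :=
  GRing.isLinear.Build R _ _ _ boundary boundary_is_linear.

(* There are no 2-cells, so H_1 is the space of 1-cycles. *)
Definition H1 : {vspace {ffun E -> R^o}} :=
  (lker (linfun symmetrization) :&: lker (linfun boundary))%VS.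

Definition genus : nat := \dim H1.

End Genus.

Section Branch.
Variables (R : realType) (V E : choiceType) (G : wgraph R V E) (e : E).

(* T(e): the connected component of the graph minus the interior of the edge
   {e, erev e} that contains the vertex [tgt e]. *)
Definition avoids (p : seq E) : Prop :=
  forall f, f \in p -> f <> e /\ f <> erev G e.

Definition branch_vertices : set V :=
  [set v | exists p, walk G (tgt G e) p v /\ avoids p].

Definition branch_edges : set E :=
  [set f | [/\ f <> e, f <> erev G e & branch_vertices (src G f)]].

Lemma branch_srcP (f : branch_edges) : src G (val f) \in branch_vertices.
Proof. by have /set_mem[_ _ ?] := valP f; exact: mem_set. Qed.

Lemma walk_rcons u p v f :
  walk G u p v -> src G f = v -> walk G u (rcons p f) (tgt G f).
Proof. by elim: p u => [|g p IH] u /= => [-> | [? /IH h] /h]. Qed.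

Lemma branch_erevP (f : branch_edges) : erev G (val f) \in branch_edges.
Proof.
have /set_mem[fe fre [p [wp ap]]] := valP f.
apply/mem_set; split.
- by move=> h; apply: fre; rewrite -h erevK.
- by move=> /(can_inj (@erevK _ _ _ G)).
exists (rcons p (val f)); split; first exact: walk_rcons wp erefl.
by move=> g; rewrite mem_rcons inE => /orP[/eqP -> //|/ap].
Qed.

Definition branch_src (f : branch_edges) : branch_vertices :=
  exist _ (src G (val f)) (branch_srcP f).

Definition branch_erev (f : branch_edges) : branch_edges :=
  exist _ (erev G (val f)) (branch_erevP f).

Definition branch_len (f : branch_edges) : R := len G (val f).

Lemma branch_erevK : involutive branch_erev.
Proof. by move=> f; apply: val_inj; rewrite /= erevK. Qed.

Lemma branch_erev_neq f : branch_erev f <> f.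
Proof. by move=> /(congr1 val) /=; exact: erev_neq. Qed.

Lemma branch_len_gt0 f : 0 < branch_len f.
Proof. exact: len_gt0. Qed.

Lemma branch_len_erev f : branch_len (branch_erev f) = branch_len f.
Proof. exact: len_erev. Qed.

Lemma branch_finite_valence v : finite_set [set f | branch_src f = v].
Proof.
have h : finite_set ((val : branch_edges -> E) @^-1` [set f | src G f = val v]).
  apply: finite_preimage (finite_valence G (val v)).
  by move=> x y _ _; exact: val_inj.
by apply: sub_finite_set h => f /= <-.
Qed.

Definition branch : wgraph R branch_vertices branch_edges :=
  WGraph branch_erevK branch_erev_neq branch_len_gt0 branch_len_erev
    branch_finite_valence.

Lemma branch_rootP : tgt G e \in branch_vertices.
Proof. by apply/mem_set; exists [::]; split. Qed.

Definition branch_root : branch_vertices := exist _ (tgt G e) branch_rootP.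

Definition resistance : \bar R :=
  if `[< transient branch >]
  then ereal_inf [set sqnorm branch w | w in unit_flows branch branch_root]
  else +oo%E.

End Branch.

(* A universal cover of the metric graph modelled by G, with the model whose
   vertices are the preimages of those of G: a simply connected weighted graph
   with a morphism to G that preserves lengths and is bijective on stars. *)
Record universal_cover (R : realType) (V E V' E' : choiceType)
    (G : wgraph R V E) (G' : wgraph R V' E') := UniversalCover {
  phiV : V' -> V;
  phiE : E' -> E;
  phi_src : forall e', src G (phiE e') = phiV (src G' e');
  phi_erev : forall e', phiE (erev G' e') = erev G (phiE e');
  phi_len : forall e', len G (phiE e') = len G' e';
  phi_surj : forall v, exists v', phiV v' = v;
  phi_star : forall v' e, src G e = phiV v' ->
    exists! e', src G' e' = v' /\ phiE e' = e;
  cover_simply_connected : simply_connected G'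
}.

Section Cover.
Variables (R : realType) (V E V' E' : choiceType).
Variables (G : wgraph R V E) (G' : wgraph R V' E').
Variable phi : universal_cover G G'.

Lemma phiE_surj e : exists e', phiE phi e' = e.
Proof.
have [v' v'E] := phi_surj phi (src G e).
by have [e' [[_ e'E] _]] := phi_star (esym v'E); exists e'.
Qed.

(* Computed on a chosen lift of e. *)
Definition Rfun (e : E) : \bar R :=
  resistance G' (projT1 (cid (phiE_surj e))).

End Cover.

(* Main.v *)
Require Import Defs.
From HB Require Import structures.
From mathcomp Require Import all_boot all_order all_algebra.
From mathcomp Require Import all_classical all_reals all_analysis.
From mathcomp Require Import ring lra.

Set Implicit Arguments.
Unset Strict Implicit.
Unset Printing Implicit Defensive.

Import Order.TTheory GRing.Theory Num.Theory.

Local Open Scope classical_set_scope.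
Local Open Scope ring_scope.

(* Reduced edge paths of G starting with e enumerate the edges of T(e) directed
   away from e, so an L^2 form with d^* = delta at the root of T(e) is the same
   as a finite energy function t on these paths with t = 1 on the trivial path
   and t p equal to the sum of t over the one-edge prolongations of p. Splitting
   a path after its first edge f, and writing c_f for the flow through f, the
   energy becomes the sum over f in S_e of c_f^2 l(f) plus the energy of a
   c_f-multiple of a unit flow for f, hence at least the sum of
   c_f^2 (l(f) + R(f)), and arbitrarily close to it. As the c_f sum up to 1, the
   infimum is that of a parallel connection of resistances l(f) + R(f). *)

(** * Reduced walks in a simply connected graph *)

Section Walks.
Variables (R : realType) (V E : choiceType) (G : wgraph R V E).
Implicit Types (p q s : seq E) (e f g : E) (u v : V).

Lemma tgt_erev e : tgt G (erev G e) = src G e.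
Proof. by rewrite /tgt erevK. Qed.

Lemma walk_cat u v w p q : walk G u p v -> walk G v q w -> walk G u (p ++ q) w.
Proof. by elim: p u => [|e p IH] u /= => [-> //|[-> /IH h] /h]. Qed.

Lemma walk_rcons_inv u v p f :
  walk G u (rcons p f) v -> walk G u p (src G f) /\ v = tgt G f.
Proof. by elim: p u => [|e p IH] u /= => [[-> <-]|[-> /IH []]]. Qed.

Lemma walk_rev u v p : walk G u p v -> walk G v (rev (map (erev G) p)) u.
Proof.
elim: p u => [|e p IH] u /= => [-> //|[<- /IH h]].
by rewrite rev_cons -tgt_erev; exact: walk_rcons h _.
Qed.

Definition reduced p := sorted (fun e f => f != erev G e) p.

(** Left multiplication by [f] on reduced words, with [erev G f] as the inverse of [f]. *)
Definition push f s :=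
  if s is g :: t then if g == erev G f then t else f :: s else [:: f].

Definition reduction p := foldr push [::] p.

Lemma push_reduced f s : reduced s -> reduced (push f s).
Proof.
case: s => [//|g t] /= gt; case: ifPn => /= [_|-> //].
by case: t gt => // h t /= /andP[].
Qed.

(** If the inner push cancels a leading [f], reducedness keeps the next letter from being
    [erev G f], so the outer push restores [f]. *)
Lemma pushK f s : reduced s -> push f (push (erev G f) s) = s.
Proof.
case: s => [_|g t] /=; first by rewrite eqxx.
rewrite erevK; case: eqVneq => [->|_] /=; last by rewrite eqxx.
by case: t => // h t /= /andP[/negbTE ->].
Qed.

Lemma reduction_reduced p : reduced (reduction p).
Proof. by elim: p => //= f p; exact: push_reduced. Qed.

Lemma reduction_id p : reduced p -> reduction p = p.
Proof.
elim: p => // f [//|g p] IH /= /andP[gf gp].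
change (push f (reduction (g :: p)) = [:: f, g & p]).
by rewrite IH //= (negbTE gf).
Qed.

Lemma homotopic_reduction p q : homotopic G p q -> reduction p = reduction q.
Proof.
elim=> [{}p {}q e||_ _ _ -> //|_ {p q}q _ _ -> _ -> //] //.
by rewrite /reduction !foldr_cat /= pushK//; exact: reduction_reduced.
Qed.

Lemma homotopic_cat s t p q :
  homotopic G p q -> homotopic G (s ++ p ++ t) (s ++ q ++ t).
Proof.
elim=> [{}p {}q e|{}p|{}p {}q _|p1 p2 p3 _ h1 _ h2].
- by rewrite -!catA /= !(catA s p); exact: homotopic_backtrack.
- exact: homotopic_refl.
- exact: homotopic_sym.
- exact: homotopic_trans h1 h2.
Qed.

(** With [q'] the reverse of [q], the loops [p ++ q'] and [q' ++ q] contract, so [p] and [q] are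
    both homotopic to [p ++ q' ++ q]. *)
Lemma reduced_walk_unique u v p q : simply_connected G ->
  walk G u p v -> walk G u q v -> reduced p -> reduced q -> p = q.
Proof.
move=> [_ sc] wp wq rp rq; rewrite -(reduction_id rp) -(reduction_id rq).
apply: homotopic_reduction; set q' := rev (map (erev G) q).
have wq' : walk G v q' u by exact: walk_rev.
have /sc/(homotopic_cat [::] q) pq := walk_cat wp wq'.
have /sc/(homotopic_cat p [::]) qp := walk_cat wq' wq.
move: pq qp; rewrite /= !cats0 -catA => pq qp.
exact: homotopic_trans (homotopic_sym qp) pq.
Qed.

(** For fixed [e] this is membership in the set S_e of the theorem. *)
Definition step : rel E :=
  fun e f => (f != erev G e) && (src G f == tgt G e).

Lemma step_path_walk e p : path step e p ->
  walk G (src G e) (e :: p) (tgt G (last e p)).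
Proof.
elim: p e => [|f p IH] e /=; first by [].
by move=> /andP[/andP[_ /eqP fe] /IH [_ ?]]; split=> //; split.
Qed.

Lemma step_path_reduced e p : path step e p -> reduced (e :: p).
Proof. by apply: sub_path => ? ? /andP[]. Qed.

Hypothesis sc : simply_connected G.

Lemma step_path_tgt_inj e p q : path step e p -> path step e q ->
  tgt G (last e p) = tgt G (last e q) -> p = q.
Proof.
move=> ep eq pq; suff [] : e :: p = e :: q by [].
apply: (reduced_walk_unique sc (step_path_walk ep)).
- by rewrite pq; exact: step_path_walk.
- exact: step_path_reduced.
- exact: step_path_reduced.
Qed.

Lemma step_path_last_inj e p q : path step e p -> path step e q ->
  last e p = last e q -> p = q.
Proof. by move=> ep eq pq; apply: step_path_tgt_inj ep eq _; rewrite pq. Qed.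

(** Otherwise [p] would end where [q] without its last edge [g] ends, hence equal it, and [g] would
    backtrack; for empty [q], the reduced walk [e :: p] would be closed. *)
Lemma step_path_last_erev e p q : path step e p -> path step e q ->
  last e p <> erev G (last e q).
Proof.
case/lastP: q => [|q g] pe eq; rewrite ?last_rcons => h.
  suff : e :: p = [::] by [].
  have := step_path_walk pe; rewrite h tgt_erev => w.
  exact: (reduced_walk_unique sc w (q := [::]) _ (step_path_reduced pe)).
move: eq; rewrite rcons_path => /andP[eq /andP[gq /eqP sg]].
have pq : p = q by apply: (step_path_tgt_inj pe eq); rewrite h tgt_erev.
by move: gq; rewrite -pq h erevK eqxx.
Qed.

Lemma step_path_branch_edges e p : path step e p -> p <> [::] ->
  last e p \in branch_edges G e.
Proof.
move=> ep p0; apply/mem_set; split.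
- by move=> h; apply: p0; apply: (step_path_last_inj ep (q := [::])).
- exact: (step_path_last_erev ep (q := [::])).
case/lastP: p p0 ep => // p f _; rewrite last_rcons rcons_path.
move=> /andP[ep /andP[_ /eqP ->]]; exists p; split.
  by have [] := step_path_walk ep.
elim/last_ind: p ep => // p g IH; rewrite rcons_path => /andP[ep eg] h.
rewrite mem_rcons inE => /predU1P[->|]; last exact: IH.
have epg : path step e (rcons p g) by rewrite rcons_path ep.
split.
- rewrite -(last_rcons e p g) => pg.
  have /(congr1 size) := step_path_last_inj epg (q := [::]) isT pg.
  by rewrite size_rcons.
- by rewrite -(last_rcons e p g); exact: (step_path_last_erev epg (q := [::])).
Qed.

(* An edge leaving the end of a step path either prolongs it or is the reverse
   of its last edge. *)
Lemma step_path_next e p f : path step e p -> src G f = tgt G (last e p) ->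
  f = erev G (last e p) \/ path step e (rcons p f).
Proof.
move=> ep sf; rewrite rcons_path ep /step sf eqxx andbT.
by case: eqVneq => [|_]; [left|right].
Qed.

(** A next edge of the walk that backtracks is absorbed by deleting the last edge of the path. On
    the trivial path it would be [erev G e], which the walk avoids. *)
Lemma branch_vertices_path e v : branch_vertices G e v ->
  exists2 p, path step e p & tgt G (last e p) = v.
Proof.
move=> [q []]; elim/last_ind: q v => [|q g IH] v.
  by move=> /= <- _; exists [::].
move=> /walk_rcons_inv[qg ->] av.
have [f fq|p ep pg] := IH _ qg; first by apply: av; rewrite mem_rcons inE fq orbT.
have [_ ge] : g <> e /\ g <> erev G e by apply: av; rewrite mem_rcons mem_head.
case: (step_path_next ep (esym pg)) => [gp|]; last first.
  by exists (rcons p g) => //; rewrite last_rcons.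
case/lastP: p ep gp {pg} => [//|p h]; rewrite rcons_path last_rcons.
move=> /andP[ep /andP[_ /eqP sh]] gh; exists p => //.
by rewrite gh tgt_erev.
Qed.

Lemma branch_edges_path e f : branch_edges G e f ->
  exists p, [/\ path step e p, p <> [::] &
                 last e p = f \/ last e p = erev G f].
Proof.
move=> [_ fe /branch_vertices_path[p ep pf]].
case: (step_path_next ep (esym pf)) => [fp|epf]; last first.
  by exists (rcons p f); split=> //; [case: (p)|rewrite last_rcons; left].
by exists p; split=> //; [move=> p0; move: fp; rewrite p0|right; rewrite fp erevK].
Qed.

End Walks.

(** * Flows on a branch of a tree as functions of reduced paths *)

Section Forms.
Variables (R : realType) (V E : choiceType) (G : wgraph R V E).

Lemma slope_erev w e : cochain G w -> slope G w (erev G e) = - slope G w e.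
Proof. by move=> cw; rewrite /slope cw len_erev mulNr. Qed.

(** Reversing the edges that end at [v] turns the incoming sum into minus the sum over the edges
    leaving [v] outside the orientation. *)
Lemma dstarE w v : cochain G w ->
  dstar G w v = - \sum_(f \in [set f | src G f = v]) slope G w f.
Proof.
move=> cw; rewrite /dstar.
rewrite [in RHS](fsbigID (orientation G)); last exact: finite_valence.
rewrite opprD addrC setIC; congr (_ + _).
rewrite (reindex_fsbig (erev G) ([set f | src G f = v] `&` ~` orientation G)
  (orientation G `&` [set f | tgt G f = v])) /=.
  under eq_fsbigr do rewrite slope_erev// -mulN1r.
  by rewrite -mulr_fsumr mulN1r.
split.
- move=> f [/= fv nO]; split; last by rewrite /= tgt_erev.
  by apply: contrapT => /orientationP; rewrite erevK.
- by move=> f g _ _; exact: (can_inj (erevK G)).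
- move=> f [/= Of fv]; exists (erev G f); last exact: erevK.
  by split => //; apply/orientationP; rewrite erevK.
Qed.

Definition identity_subdivision : subdivision G G.
Proof.
apply: (@Subdivision _ _ _ _ _ G G id (fun e => [:: e])) => //.
- by move=> e; rewrite big_seq1.
- move=> f; exists f; split; first exact: mem_head.
  by move=> g; rewrite inE => /eqP.
- by move=> e [|? [|]].
- by move=> w /(_ w).
Qed.

Lemma unit_flow_transient x w : unit_flows G x w -> transient G.
Proof. by move=> xw; exists V, E, G, identity_subdivision, x, w. Qed.

End Forms.

(* No case distinction: a branch without unit flow at its root has infimum
   +oo over the empty set, and any unit flow is a witness of transience. *)
Lemma resistanceE (R : realType) (V E : choiceType) (G : wgraph R V E) e :
  resistance G e = ereal_inf [set sqnorm (branch G e) w |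
                               w in unit_flows (branch G e) (branch_root G e)].
Proof.
rewrite /resistance; case: asboolP => // ntr.
suff -> : unit_flows (branch G e) (branch_root G e) = set0.
  by rewrite image_set0 ereal_inf0.
by rewrite -subset0 => w /unit_flow_transient.
Qed.

Section WordFlows.
Variables (R : realType) (V E : choiceType) (G : wgraph R V E).

(* In a tree, the step paths [p <> [::]] from [e] enumerate, through
   [last e p], the edges of T(e) directed away from e; [t p] is the flow, in
   this direction, along such an edge, and [t [::]] the flow entering at the
   root. On a finite graph the same words describe its universal cover. *)
Definition kirchhoff e (t : seq E -> R) := forall p, path (step G) e p ->
  t p = \sum_(f \in [set f | step G (last e p) f]) t (rcons p f).

Definition words e := [set p | path (step G) e p /\ p <> [::]].

Definition energy e (t : seq E -> R) : \bar R :=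
  (\esum_(p in words e) (t p ^+ 2 * len G (last e p))%:E)%E.

Definition unit_word_flows e :=
  [set t | [/\ kirchhoff e t, t [::] = 1 & (energy e t < +oo)%E]].

Definition word_resistance e : \bar R :=
  ereal_inf [set energy e t | t in unit_word_flows e].

Hypothesis sc : simply_connected G.

Section Correspondence.
Variables (e : E) (w : branch_edges G e -> R) (t : seq E -> R).
Hypothesis cw : cochain (branch G e) w.
Hypothesis t0 : t [::] = 1.
(* The sign comes from d^*, which counts what flows into a vertex. *)
Hypothesis wt : forall p b, words e p -> val b = last e p ->
  slope (branch G e) w b = - t p.

Let branch_of p (ep : words e p) : branch_edges G e :=
  exist _ (last e p) (step_path_branch_edges sc ep.1 ep.2).

Definition edge_word (b : branch_edges G e) : seq E :=
  xget [::] [set p | words e p /\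
    (last e p = val b \/ last e p = erev G (val b))].

Lemma edge_wordP b : words e (edge_word b) /\
  (last e (edge_word b) = val b \/ last e (edge_word b) = erev G (val b)).
Proof.
rewrite /edge_word; case: xgetP => [p -> //|nex].
have /set_mem/branch_edges_path[p [? ? ?]] := valP b.
by have := nex p; case.
Qed.

Lemma edge_word_unique b p : words e p ->
  last e p = val b \/ last e p = erev G (val b) -> edge_word b = p.
Proof.
have [[+ _] +] := edge_wordP b; move: (edge_word b) => q eq qb [ep _] pb.
have pq : last e p <> erev G (last e q) by exact: step_path_last_erev.
have qp : last e q <> erev G (last e p) by exact: step_path_last_erev.
apply: (step_path_last_inj sc eq ep).
by case: qb pb pq qp => -> [] ->; rewrite ?erevK.
Qed.

(** Both sides list each geometric edge of T(e) once: an orientation picks one direction of it, and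
    words reach it in exactly one direction. *)
Lemma edge_word_bij : set_bij (orientation (branch G e)) (words e) edge_word.
Proof.
split.
- by move=> b _; have [] := edge_wordP b.
- move=> b c /set_mem Ob /set_mem Oc bc.
  have [_] := edge_wordP b; have [_] := edge_wordP c; rewrite bc.
  have Orev (x y : branch_edges G e) : orientation (branch G e) x ->
      orientation (branch G e) y -> val x <> erev G (val y).
    move=> + Oy xy; have -> : x = erev (branch G e) y by exact: val_inj.
    by move=> Oy'; have /orientationP := Oy; apply.
  case=> -> [] h; apply: val_inj => //.
  + by case: (Orev _ _ Oc Ob).
  + by case: (Orev _ _ Ob Oc).
  + by apply: (can_inj (erevK G)).
- move=> p ep; have [Ob|nOb] := pselect (orientation (branch G e) (branch_of ep)).
    by exists (branch_of ep) => //; apply: (edge_word_unique ep); left.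
  exists (erev (branch G e) (branch_of ep)).
    by apply: contrapT => /orientationP/contrapT; rewrite erevK.
  by apply: (edge_word_unique ep); right; rewrite /= erevK.
Qed.

Lemma sqnorm_energy : sqnorm (branch G e) w = energy e t.
Proof.
rewrite /energy (reindex_esum _ _ _ _ edge_word_bij); apply: eq_esum => b _.
have [eb [bE|bE]] := edge_wordP b; rewrite bE.
  by rewrite (wt eb (esym bE)) sqrrN.
have bE' : val (erev (branch G e) b) = last e (edge_word b) by rewrite bE.
by rewrite len_erev -(sqrrN (t _)) -(wt eb bE') slope_erev// sqrrN.
Qed.

(** The edges leaving the end of [p] are its one-edge prolongations and the reverse of its last
    edge; for [p = [::]] the latter is [erev G e], outside T(e). *)
Lemma dstar_word p v : path (step G) e p -> val v = tgt G (last e p) ->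
  dstar (branch G e) w v =
  \sum_(f \in [set f | step G (last e p) f]) t (rcons p f)
  - (if p is [::] then 0 else t p).
Proof.
move=> ep vp; rewrite dstarE//.
pose A := [set b : branch_edges G e | val b = erev G (last e p)].
pose B := [set b : branch_edges G e | step G (last e p) (val b)].
have srcE (b : branch_edges G e) : src (branch G e) b = v <->
    src G (val b) = tgt G (last e p).
  by rewrite -vp; split=> [<- //|bv]; exact: val_inj.
have srcAB : [set b | src (branch G e) b = v] = A `|` B.
  apply/seteqP; split=> b /=; rewrite srcE.
    move=> sb; have [bE|] := eqVneq (val b) (erev G (last e p)); [by left|right].
    by rewrite /B /= /step sb eqxx andbT.
  by case=> [->//|/andP[_ /eqP]].
have finAB : finite_set (A `|` B) by rewrite -srcAB; exact: finite_valence.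
rewrite srcAB fsbigU0; last first.
- by move=> b [/= bE]; rewrite /B /= /step bE eqxx.
- by apply: sub_finite_set finAB; exact: subsetUr.
- by apply: sub_finite_set finAB; exact: subsetUl.
rewrite opprD addrC; congr (_ + - _).
  rewrite (reindex_fsbig val B).
    rewrite -mulN1r mulr_fsumr; apply: eq_fsbigr => b /set_mem bB.
    rewrite (wt (p := rcons p (val b))) ?mulN1r ?opprK ?last_rcons//.
    by split; [rewrite rcons_path ep|case: (p)].
  split=> //; first by move=> b c _ _; exact: val_inj.
  move=> f /= pf.
  have epf : words e (rcons p f).
    by split; [rewrite rcons_path ep|case: (p)].
  by exists (branch_of epf); rewrite /B /= last_rcons.
case: p ep vp @A {B srcE srcAB finAB} => [|f p] ep vp A.
  by apply: fsbig1 => b bE; have /set_mem[_ +] := valP b; rewrite bE.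
have fpe : words e (f :: p) by [].
suff -> : A = [set erev (branch G e) (branch_of fpe)].
  by rewrite fsbig_set1 slope_erev// (wt fpe)// opprK.
by apply/seteqP; split=> b /= => [bE|-> //]; exact: val_inj.
Qed.

Lemma dstar_word_dirac p v : path (step G) e p -> val v = tgt G (last e p) ->
  dstar (branch G e) w v = dirac_mass R (branch_root G e) v <->
  t p = \sum_(f \in [set f | step G (last e p) f]) t (rcons p f).
Proof.
move=> ep vp; rewrite (dstar_word ep vp) /dirac_mass.
have -> : (v == branch_root G e) = (p == [::]).
  apply/eqP/eqP => [vr|p0].
    by apply: (step_path_tgt_inj sc (e := e) ep) => //; rewrite -vp vr.
  by apply: val_inj; rewrite /= vp p0.
case: p {ep vp} => [|f p] /=.
  by rewrite subr0 t0; split=> /esym.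
split=> [/eqP|<-]; last by rewrite subrr.
by rewrite subr_eq0 => /eqP.
Qed.

Lemma dstar_kirchhoff :
  dstar (branch G e) w = dirac_mass R (branch_root G e) <-> kirchhoff e t.
Proof.
split=> [dw p ep|kt].
  have vp : tgt G (last e p) \in branch_vertices G e.
    case: p ep => [_|f p fpe]; first exact: branch_rootP.
    have ep : words e (f :: p) by [].
    by rewrite /tgt; exact: (branch_srcP (branch_erev (branch_of ep))).
  pose v : branch_vertices G e := exist _ (tgt G (last e p)) vp.
  by apply/(dstar_word_dirac (v := v)); rewrite ?dw.
apply/funext => v; have /set_mem/branch_vertices_path[p ep /esym pv] := valP v.
by apply/(dstar_word_dirac ep pv)/kt.
Qed.

End Correspondence.
Lemma resistance_word e : resistance G e = word_resistance e.
Proof.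
rewrite resistanceE /word_resistance; congr ereal_inf; apply/seteqP; split=> x /=.
  move=> [w [cw Lw dw] <-].
  (* The default 0 is never reached on [words e], whose last edges lie in the branch. *)
  pose t p := if p is [::] then 1 else
    - (if insub (last e p) is Some b then slope (branch G e) w b else 0).
  have wt p b : words e p -> val b = last e p -> slope (branch G e) w b = - t p.
    by case: p => [[]//|f p _ /= <-]; rewrite valK opprK.
  exists t; last by rewrite -(sqnorm_energy cw wt).
  split=> //; first by apply/(dstar_kirchhoff cw _ wt).
  by rewrite -(sqnorm_energy cw wt).
move=> [t [kt t0 Lt] <-].
(* [W] carries the slope on edges directed away from [e] and vanishes on their reverses;
   antisymmetrizing it and multiplying by the length, which [slope] divides out, gives the cochain
   [w]. *)
pose W f := if `[< exists2 p, words e p & last e p = f >]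
  then - t (xget [::] [set p | words e p /\ last e p = f]) else 0.
have WE p : words e p -> W (last e p) = - t p.
  move=> ep; rewrite /W asboolT; last by exists p.
  congr (- t _); case: xgetP => [q _ [eq qp]|/(_ p)[]//].
  by apply: (step_path_last_inj sc eq.1 ep.1).
have WN p : words e p -> W (erev G (last e p)) = 0.
  move=> ep; rewrite /W asboolF// => -[q eq].
  exact: (step_path_last_erev sc eq.1 ep.1).
pose w (b : branch_edges G e) :=
  (W (val b) - W (erev G (val b))) * len G (val b).
have cw : cochain (branch G e) w.
  by move=> b; rewrite /w /= erevK len_erev -mulNr opprB.
have wt p b : words e p -> val b = last e p -> slope (branch G e) w b = - t p.
  move=> ep bp; rewrite /slope /w /= mulfK ?gt_eqF ?len_gt0//.
  by rewrite bp WE// WN// subr0.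
exists w; last exact: sqnorm_energy.
split=> //; first by rewrite /L2 (sqnorm_energy cw wt).
by apply/(dstar_kirchhoff cw t0 wt).
Qed.

End WordFlows.

(** * Reduced paths in a cover *)

Section CoverWords.
Variables (R : realType) (V E V' E' : choiceType).
Variables (G : wgraph R V E) (G' : wgraph R V' E').
Variable phi : universal_cover G G'.
Implicit Types (a f g : E') (p q : seq E').

Lemma phi_tgt a : tgt G (phiE phi a) = phiV phi (tgt G' a).
Proof. by rewrite /tgt -phi_erev phi_src. Qed.

Lemma phiE_inj f g : src G' f = src G' g -> phiE phi f = phiE phi g -> f = g.
Proof.
move=> fg pfg; have [h [_ hu]] := phi_star (phi_src phi f).
by rewrite -(hu f)// -(hu g).
Qed.

(** The cover is bijective on stars and commutes with reversal, so the excluded backtracking edges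
    correspond. *)
Lemma phi_step_bij a : set_bij [set f | step G' a f]
  [set h | step G (phiE phi a) h] (phiE phi).
Proof.
split.
- move=> f /= /andP[fa /eqP sf]; apply/andP; split.
    apply: contra fa => /eqP; rewrite -phi_erev => fa.
    by apply/eqP/phiE_inj; first by rewrite sf.
  by rewrite phi_src sf phi_tgt.
- move=> f g /set_mem /andP[_ /eqP sf] /set_mem /andP[_ /eqP sg].
  by apply: phiE_inj; rewrite sf sg.
- move=> h /= /andP[ha]; rewrite phi_tgt => /eqP/phi_star[f [[sf fh] _]].
  exists f => //; apply/andP; split; last by rewrite sf.
  by apply: contra ha => /eqP fa; rewrite -fh fa phi_erev.
Qed.

Lemma phi_path a p : path (step G') a p ->
  path (step G) (phiE phi a) (map (phiE phi) p).
Proof.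
elim: p a => //= f p IH a /andP[af /IH ->]; rewrite andbT.
by have [+ _ _] := phi_step_bij a; apply.
Qed.

Lemma phi_path_lift a (q : seq E) : path (step G) (phiE phi a) q ->
  exists2 p, path (step G') a p & map (phiE phi) p = q.
Proof.
elim: q a => [|h q IH] a /=; first by exists [::].
have [_ _ surj] := phi_step_bij a; move=> /andP[/surj[f af <-] /IH[p fp <-]].
by exists (f :: p); rewrite //= fp andbT.
Qed.

Lemma phi_path_inj a p q : path (step G') a p -> path (step G') a q ->
  map (phiE phi) p = map (phiE phi) q -> p = q.
Proof.
elim: p q a => [|f p IH] [|g q] a //= /andP[af fp] /andP[ag gq] [fg pq].
have [_ inj _] := phi_step_bij a; have fgE := inj _ _ (mem_set af) (mem_set ag) fg.
by rewrite -fgE in gq *; rewrite (IH _ _ fp gq).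
Qed.

Lemma phi_words_bij a :
  set_bij (words G' a) (words G (phiE phi a)) (map (phiE phi)).
Proof.
split.
- by move=> p [/phi_path ap p0]; split=> //; case: p p0 {ap}.
- by move=> p q /set_mem[ap _] /set_mem[aq _]; exact: phi_path_inj ap aq.
- move=> q [/phi_path_lift[p ap <-] p0]; exists p => //.
  by split=> //; case: p p0 {ap}.
Qed.

Section Transport.
Variables (a : E') (t : seq E -> R) (t' : seq E' -> R).
Hypothesis tt' : forall p, path (step G') a p -> t' p = t (map (phiE phi) p).

Lemma energy_phi : energy G' a t' = energy G (phiE phi a) t.
Proof.
rewrite /energy (reindex_esum _ _ _ _ (phi_words_bij a)).
apply: eq_esum => p [ap _]; rewrite tt'// last_map.
by rewrite phi_len.
Qed.

Lemma kirchhoff_phi_sum p : path (step G') a p ->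
  \sum_(f \in [set f | step G' (last a p) f]) t' (rcons p f) =
  \sum_(h \in [set h | step G (last (phiE phi a) (map (phiE phi) p)) h])
    t (rcons (map (phiE phi) p) h).
Proof.
move=> ap; rewrite last_map (reindex_fsbig _ _ _ _ (phi_step_bij _)).
apply: eq_fsbigr => f /set_mem pf.
by rewrite tt' ?map_rcons// rcons_path ap.
Qed.

Lemma kirchhoff_phi : kirchhoff G' a t' <-> kirchhoff G (phiE phi a) t.
Proof.
split=> kt p.
  by move=> /phi_path_lift[q aq <-]; rewrite -tt'// kt// kirchhoff_phi_sum.
move=> ap; rewrite kirchhoff_phi_sum// tt'//; exact/kt/phi_path.
Qed.

End Transport.

(** Unique path lifting identifies the two flow problems. The right side sees only the projection of
    [a], hence all lifts of an edge have the same resistance. *)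
Lemma word_resistance_phi a :
  word_resistance G' a = word_resistance G (phiE phi a).
Proof.
congr ereal_inf; apply/seteqP; split=> x /= [t [kt t0 Lt] <-].
  pose u (q : seq E) := t (xget [::] [set p | path (step G') a p /\ map (phiE phi) p = q]).
  have tu p : path (step G') a p -> t p = u (map (phiE phi) p).
    move=> ap; rewrite /u; case: xgetP => [q _ [aq pq]|/(_ p)[]//].
    by rewrite (phi_path_inj aq ap pq).
  exists u; last by rewrite (energy_phi tu).
  split; [exact/(kirchhoff_phi tu)| |by rewrite -(energy_phi tu)].
  by rewrite -t0 (tu [::]).
pose u p := t (map (phiE phi) p).
exists u; last exact: energy_phi.
split=> //; [exact/(@kirchhoff_phi a t)|by rewrite (energy_phi (t := t))].
Qed.

End CoverWords.

(** * The series-parallel law *)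

Lemma fsbig_finType (T : finType) (R : Type) (idx : R) (op : Monoid.com_law idx)
    (P : pred T) (F : T -> R) :
  \big[op/idx]_(x \in [set x | P x]) F x = \big[op/idx]_(x | P x) F x.
Proof.
by rewrite [RHS]bigfs ?index_enum_uniq// => x _; rewrite mem_index_enum.
Qed.

Section Series.
Local Open Scope ereal_scope.
Variables (R : realType) (V E : finType) (G : wgraph R V E).
Implicit Types (e f : E) (p q : seq E) (t : seq E -> R).

Lemma kirchhoff_finType e t : kirchhoff G e t <-> forall p, path (step G) e p ->
  t p = (\sum_(f | step G (last e p) f) t (rcons p f))%R.
Proof. by split=> kt p /kt ->; rewrite fsbig_finType. Qed.

Lemma word_term_ge0 e t p : 0 <= (t p ^+ 2 * len G (last e p))%:E.
Proof. by rewrite lee_fin mulr_ge0 ?sqr_ge0 ?ltW ?len_gt0. Qed.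

Lemma energy_ge0 e t : 0 <= energy G e t.
Proof. by apply: esum_ge0 => p _; exact: word_term_ge0. Qed.

Lemma word_resistance_ge0 e : 0 <= word_resistance G e.
Proof. by apply: le_ereal_inf_tmp => _ [t _ <-]; exact: energy_ge0. Qed.

(** A nonempty word is a first edge [f] followed by a step path from [f]; the empty remainder
    contributes the term of [f] itself. *)
Lemma energy_step e t : energy G e t =
  \sum_(f | step G e f)
     ((t [:: f] ^+ 2 * len G f)%:E + energy G f (fun q => t (f :: q))).
Proof.
pose J f := [set q | path (step G) f q].
have bij : set_bij ([set f | step G e f] `*`` J) (words G e)
    (fun x => x.1 :: x.2).
  split.
  - by move=> [f q] [/= ef fq]; split=> //=; rewrite ef.
  - by move=> [f q] [g r] _ _ /= [-> ->].
  - by move=> [|f q] [//= /andP[ef fq] _]; exists (f, q).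
rewrite /energy (reindex_esum _ _ _ _ bij).
rewrite -(@esum_esum _ _ _ _ J
  (fun f q => (t (f :: q) ^+ 2 * len G (last f q))%:E)); last first.
  by move=> f q _ _; exact: (word_term_ge0 e t (f :: q)).
rewrite esum_fset//; last first.
- by move=> f _; apply: esum_ge0 => q _; exact: (word_term_ge0 e t (f :: q)).
- exact: finite_finset.
rewrite fsbig_finType; apply: eq_bigr => f ef.
rewrite (esumID [set [::]]); last first.
  by move=> q _; exact: (word_term_ge0 e t (f :: q)).
congr (_ + _).
rewrite [J f `&` _](_ : _ = [set [::]]); last first.
  by apply/seteqP; split=> [q []//|_ ->].
by rewrite esum_set1//; exact: (word_term_ge0 e t [:: f]).
Qed.

Lemma kirchhoff_step e f t : step G e f -> kirchhoff G e t ->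
  kirchhoff G f (fun q => t (f :: q)).
Proof. by move=> ef kt p fp; rewrite kt //= ef. Qed.

Lemma energyZ e t (a : R) :
  energy G e (fun p => a * t p)%R = (a ^+ 2)%:E * energy G e t.
Proof.
(* Pulling the factor out of the supremum requires it positive; for [a = 0] the energy may be
   infinite and [0 * +oo = 0] applies. *)
have [->|a0] := eqVneq a 0%R.
  by rewrite expr0n mul0e /energy esum1// => p _; rewrite mul0r expr0n mul0r.
rewrite /energy /esum -ereal_sup_pZl ?exprn_even_gt0// image_comp.
congr ereal_sup; apply: eq_imagel => A _ /=.
rewrite ge0_mule_fsumr; last by move=> p; exact: word_term_ge0.
by apply: eq_fsbigr => p _; rewrite exprMn -mulrA EFinM.
Qed.

Lemma kirchhoffZ e t (a : R) :
  kirchhoff G e t -> kirchhoff G e (fun p => a * t p)%R.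
Proof. by move=> kt p ep; rewrite kt// mulr_fsumr. Qed.

(** Dividing a flow of finite energy by [t [::]], when nonzero, gives a unit flow, and energy is
    quadratic. *)
Lemma le_word_resistance e t : kirchhoff G e t ->
  (t [::] ^+ 2)%:E * word_resistance G e <= energy G e t.
Proof.
move=> kt; have [->|t0] := eqVneq (t [::]) 0%R.
  by rewrite expr0n mul0e energy_ge0.
have [->|Et] := eqVneq (energy G e t) +oo; first exact: leey.
have t2 : (0 < t [::] ^+ 2)%R by rewrite exprn_even_gt0.
rewrite -lee_pdivlMl// -exprVn -energyZ; apply: ereal_inf_lbound.
exists (fun p => (t [::])^-1 * t p)%R => //; split.
- exact: kirchhoffZ.
- by rewrite mulVf.
- rewrite energyZ; apply: lte_mul_pinfty => //.
    by rewrite lee_fin sqr_ge0.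
  by rewrite ltey.
Qed.

(** [fine] loses nothing: the positive length keeps the inverse finite, and an infinite resistance
    gives 0. *)
Definition conductance e : R := fine ((len G e)%:E + word_resistance G e)^-1.

Variant conductance_spec e : \bar R -> R -> Prop :=
| ConductanceInfinite : conductance_spec e +oo 0
| ConductanceFinite r of (0 <= r)%R :
    conductance_spec e r%:E (len G e + r)^-1.

Lemma conductanceP e : conductance_spec e (word_resistance G e) (conductance e).
Proof.
rewrite /conductance; have := word_resistance_ge0 e.
case: (word_resistance G e) => [r||]//=; last first.
  by move=> _; constructor.
rewrite lee_fin => r0; rewrite -EFinD inver gt_eqF ?ltr_wpDr ?len_gt0//=.
by constructor.
Qed.

Lemma conductanceE e :
  ((len G e)%:E + word_resistance G e)^-1 = (conductance e)%:E.
Proof.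
case: conductanceP => [|r r0]; first by rewrite addey// invey.
by rewrite -EFinD inver gt_eqF// ltr_wpDr ?len_gt0.
Qed.

Lemma conductance_ge0 e : (0 <= conductance e)%R.
Proof.
by case: conductanceP => // r r0; rewrite invr_ge0 addr_ge0// ltW ?len_gt0.
Qed.

(* Linearizing [c ^ 2 / k >= 2 c s - k s ^ 2] makes sense for [k = 0] too. *)
Lemma edge_energy_ge e t (s : R) : kirchhoff G e t ->
  (2 * t [::] * s - conductance e * s ^+ 2)%:E <=
  (t [::] ^+ 2 * len G e)%:E + energy G e t.
Proof.
move=> kt; have := le_word_resistance kt; set c := t [::].
have lenc : (0 <= c ^+ 2 * len G e)%R by rewrite mulr_ge0 ?sqr_ge0 ?ltW ?len_gt0.
case: conductanceP => [|r r0].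
  have [->|c0] := eqVneq c 0%R.
    move=> _; rewrite mulr0 !mul0r subr0 adde_ge0// ?energy_ge0//.
    by rewrite lee_fin expr0n mul0r.
  rewrite gt0_muley ?lte_fin ?exprn_even_gt0// leye_eq => /eqP ->.
  by rewrite addey// leey.
move=> /(leeD2l (c ^+ 2 * len G e)%:E); apply: le_trans.
rewrite -EFinM -EFinD lee_fin -mulrDr.
have x0 : (0 < len G e + r)%R by rewrite ltr_wpDr ?len_gt0.
move: (len G e + r)%R x0 => x x0.
rewrite -subr_ge0.
have -> : (c ^+ 2 * x - (2 * c * s - x^-1 * s ^+ 2) = (c * x - s) ^+ 2 / x)%R.
  by field; rewrite gt_eqF.
by rewrite divr_ge0 ?sqr_ge0// ltW.
Qed.

(** The bounds of [edge_energy_ge] are summed with a common [s], and Kirchhoff's law at the root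
    turns the linear terms into [2 * s]. *)
Lemma word_resistance_ge e (s : R) :
  (2 * s - (\sum_(f | step G e f) conductance f) * s ^+ 2)%:E
  <= word_resistance G e.
Proof.
apply: le_ereal_inf_tmp => _ [t [kt t0 _] <-].
rewrite energy_step; apply: (@le_trans _ _ (\sum_(f | step G e f)
  (2 * t [:: f] * s - conductance f * s ^+ 2)%:E)); last first.
  by apply: lee_sum => f ef; exact: (edge_energy_ge _ (kirchhoff_step ef kt)).
rewrite sumEFin lee_fin sumrB -!mulr_suml -mulr_sumr.
by have /kirchhoff_finType/(_ [::] isT) := kt; rewrite t0 /= => <-; rewrite mulr1.
Qed.

(** By Ohm's law a potential drop [d] drives the current [conductance e * d]. The error is
    proportional to the current, so that errors add up to [eps] when currents add up to 1. *)
Lemma near_optimal_flow e (d eps : R) : (0 < d)%R -> (0 < eps)%R ->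
  exists t, [/\ kirchhoff G e t, t [::] = (conductance e * d)%R &
    (t [::] ^+ 2 * len G e)%:E + energy G e t <=
    (conductance e * d ^+ 2 + eps * (conductance e * d))%:E].
Proof.
(* Scaling the flow by the current multiplies this tolerance by its square, leaving [eps] times the
   current. *)
move=> d0 eps0; have := @lb_ereal_inf_adherent _
  [set energy G e t | t in unit_word_flows G e] (eps / (conductance e * d)).
rewrite -/(word_resistance G e); case: conductanceP => [_|r r0].
  exists (fun=> 0%R); split; rewrite ?mul0r//.
    by move=> p _; rewrite fsbig1.
  rewrite expr0n !mul0r mulr0 addr0 add0e /energy esum1// => p _.
  by rewrite expr0n mul0r.
have x0 : (0 < len G e + r)%R by rewrite ltr_wpDr ?len_gt0.
set k := (len G e + r)^-1%R; have k0 : (0 < k)%R by rewrite invr_gt0.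
case => //; first by rewrite divr_gt0// mulr_gt0.
move=> _ [t [kt t0 _] <-] /ltW tr.
exists (fun p => k * d * t p)%R; split; first exact: kirchhoffZ.
  by rewrite t0 mulr1.
rewrite energyZ t0 mulr1.
have kd2 : (0 <= (k * d) ^+ 2)%R by exact: sqr_ge0.
apply: (@le_trans _ _ (((k * d) ^+ 2 * len G e)%:E +
  ((k * d) ^+ 2)%:E * (r%:E + (eps / (k * d))%:E))).
  by apply: leeD2l; apply: lee_wpmul2l; rewrite ?lee_fin.
rewrite -(EFinD r) -(EFinM _ (r + _)) -EFinD lee_fin le_eqVlt; apply/orP; left; apply/eqP.
have kx : ((k * d) ^+ 2 * (len G e + r) = k * d ^+ 2)%R.
  by rewrite /k; field; rewrite gt_eqF.
rewrite mulrDr addrA -mulrDr kx; congr (_ + _)%R.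
by field; rewrite !gt_eqF.
Qed.

(** A drop [K^-1] across every branch gives currents [conductance f * K^-1] of sum 1; the
    near-optimal flows glue to a unit flow of energy at most [K^-1 + eps]. *)
Lemma word_resistance_le e (K := (\sum_(f | step G e f) conductance f)%R) :
  (0 < K)%R -> word_resistance G e <= K^-1%:E.
Proof.
move=> K0; apply/lee_addgt0Pr => eps eps0.
have Ki : (0 < K^-1)%R by rewrite invr_gt0.
have /choice[u uP] := fun f => near_optimal_flow f Ki eps0.
pose t p := if p is f :: q then u f q else 1%R.
have sumK : (\sum_(f | step G e f) conductance f * K^-1 = 1)%R.
  by rewrite -mulr_suml mulfV// gt_eqF.
have Et : energy G e t <= (K^-1 + eps)%:E.
  rewrite energy_step; apply: (@le_trans _ _ (\sum_(f | step G e f)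
      (conductance f * K^-1 ^+ 2 + eps * (conductance f * K^-1))%:E)).
    by apply: lee_sum => f _ /=; have [_ _] := uP f.
  rewrite sumEFin lee_fin big_split /= -mulr_sumr sumK mulr1.
  under eq_bigr do rewrite expr2 mulrA.
  by rewrite -mulr_suml sumK mul1r.
apply: ge_ereal_inf; exists (energy G e t) => //; exists t => //; split => //.
- apply/kirchhoff_finType => -[_|f q /= /andP[_ fq]].
    by rewrite /= -[LHS]sumK; apply: eq_bigr => f _; have [_ ->] := uP f.
  by have [/kirchhoff_finType/(_ q fq) + _ _] := uP f.
- by apply: le_lt_trans Et _; rewrite ltry.
Qed.

Lemma word_resistanceE e :
  word_resistance G e = (\sum_(f | step G e f) conductance f)%:E^-1.
Proof.
set K := (\sum_(f | _) _)%R.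
have : (0 <= K)%R by apply: sumr_ge0 => f _; exact: conductance_ge0.
rewrite le_eqVlt => /predU1P[K0|K0].
  rewrite -K0 inve0; have := word_resistance_ge0 e.
  (* For [K = 0] the lower bound is [2 * s] for every [s]; the choice [s = r + 1] excludes a finite
     value [r]. *)
  case: (word_resistance G e) (word_resistance_ge e) => [r||]// /(_ (r + 1)%R).
  by rewrite -/K -K0 mul0r subr0 !lee_fin => ? ?; exfalso; lra.
rewrite inver gt_eqF//; apply/eqP; rewrite eq_le word_resistance_le//=.
(* The maximum of [2 * s - K * s ^+ 2] is [K^-1], attained at [s = K^-1]. *)
apply: le_trans (word_resistance_ge e K^-1); rewrite lee_fin -/K.
by rewrite expr2 mulrA mulfV ?gt_eqF// mul1r; lra.
Qed.

Lemma word_resistance_gt0 e : 0 < word_resistance G e.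
Proof.
rewrite word_resistanceE inver; case: eqVneq => // K0.
by rewrite lte_fin invr_gt0 lt0r K0 sumr_ge0// => f _; exact: conductance_ge0.
Qed.

Lemma word_resistance_inv e : (word_resistance G e)^-1 =
  \sum_(f | step G e f) ((len G f)%:E + word_resistance G f)^-1.
Proof.
rewrite word_resistanceE inveK -sumEFin.
by apply: eq_bigr => f _; rewrite conductanceE.
Qed.

End Series.

Local Open Scope ereal_scope.

Theorem theorem7p12 (R : realType) (V E : finType) (G : wgraph R V E)
    (V' E' : choiceType) (G' : wgraph R V' E') (phi : universal_cover G G') :
  wconnected G -> (2 <= genus G)%N ->
  [/\ forall e' : E', resistance G' e' = Rfun phi (phiE phi e'),
      forall e : E, 0 < Rfun phi e
    & forall e : E,
        (Rfun phi e)^-1 =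
        \sum_(f : E | (f != erev G e) && (src G f == tgt G e))
           ((len G f)%:E + Rfun phi f)^-1 ].
Proof.
move=> _ _.
have lift_resistance e' : resistance G' e' = word_resistance G (phiE phi e').
  rewrite resistance_word ?(word_resistance_phi phi)//.
  exact: cover_simply_connected phi.
(* The lift chosen in [Rfun] projects to [e], and only this projection affects its resistance. *)
have RfunE e : Rfun phi e = word_resistance G e.
  by rewrite /Rfun; case: cid => e' /= <-; exact: lift_resistance.
split=> [e'|e|e]; rewrite !RfunE //; first exact: word_resistance_gt0.
by rewrite word_resistance_inv; apply: eq_bigr => f _; rewrite RfunE.
Qed.
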